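(* Let $N$ be a finite set with $|N|=n\ge 1$ and let $f : 2^N \to \mathbb{Q}$ be a submodular function with $f(\emptyset)=0$. Then $$\mathrm{epi}\,\hat f \;=\; \mathcal{Q}_f \;=\; \mathcal{P}_f^{\circ}\cap\big([0,1]^N\times\mathbb{R}\big).$$
   Context: A set function $f:2^N\to\mathbb{Q}$ is submodular if $f(S\cup T)+f(S\cap T)\le f(S)+f(T)$ for all $S,T\subseteq N$. For $x\in\{0,1\}^N$ write $f(x) := f(\{i\in N: x_i=1\})$. The convex hull of the epigraph of $f$ is $\mathcal{Q}_f := \mathrm{conv}\{(x,z)\in\{0,1\}^N\times\mathbb{R} : f(x)\le z\}\subseteq\mathbb{R}^N\times\mathbb{R}$. For $\pi\in\mathbb{R}^N$ and $S\subseteq N$, $\pi(S):=\sum_{i\in S}\pi_i$, and $\pi x := \sum_{i\in N}\pi_i x_i$. The polyhedron associated with $f$ is $\mathcal{P}_f := \{\pi\in\mathbb{R}^N : \pi(S)\le f(S) \text{ for all } S\subseteq N\}$, and its polar is $\mathcal{P}_f^{\circ} := \{(x,z)\in\mathbb{R}^N\times\mathbb{R} : \pi x\le z \text{ for all } \pi\in\mathcal{P}_f\}$. The Lovász extension $\hat f:[0,1]^N\to\mathbb{R}$ is defined as follows: given $x\in[0,1]^N$, order the elements of $N$ as $(1),\dots,(n)$ so that $1\ge x_{(1)}\ge\cdots\ge x_{(n)}\ge 0$, let $S_{(i)}=\{(1),\dots,(i)\}$, and set $\hat f(x) := \sum_{i=1}^{n-1}(x_{(i)}-x_{(i+1)})f(S_{(i)})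 + x_{(n)}f(S_{(n)})$ (the value does not depend on how ties are broken). Its epigraph is $\mathrm{epi}\,\hat f := \{(x,z)\in[0,1]^N\times\mathbb{R} : \hat f(x)\le z\}$. *)

(* Defs.v *)
From mathcomp Require Import all_boot all_order all_algebra.
From mathcomp Require Import classical_sets reals convex.

Set Implicit Arguments.
Unset Strict Implicit.
Unset Printing Implicit Defensive.

Import Order.TTheory GRing.Theory Num.Theory.
Local Open Scope ring_scope.
Local Open Scope classical_set_scope.

Definition submodular (N : finType) (f : {set N} -> rat) : Prop :=
  forall S T : {set N}, f (S :|: T) + f (S :&: T) <= f S + f T.

(* R^N x R; the regular module R^o provides the lmodType structure that       *)
(* convexity requires.                                                        *)
Definition point (R : realType) (N : finType) : lmodType R :=
  ({ffun N -> R^o} * R^o)%type.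

(* No convexity structure is put on the product itself: convex_lmodType is    *)
(* the alias of a module carrying its usual convex combinations, so this is   *)
(* the least convex subset of M that contains A.                              *)
Definition convex_hull (R : realType) (M : lmodType R) (A : set M) : set M :=
  smallest (fun C : set M => @convex_set R M C) A.

Definition unit_cube (R : realType) (N : finType) : set {ffun N -> R} :=
  [set x | forall i, 0 <= x i <= 1].

Definition epi_hull (R : realType) (N : finType) (f : {set N} -> rat) :
    set (point R N) :=
  convex_hull [set p : point R N |
    (forall i, p.1 i = 0 \/ p.1 i = 1) /\
    ratr (f [set i | p.1 i == 1]%SET) <= p.2 :> R].

Definition polyhedron (R : realType) (N : finType) (f : {set N} -> rat) :
    set {ffun N -> R} :=
  [set pi | forall S : {set N}, \sum_(i in S) pi i <= ratr (f S)].

Definition polar (R : realType) (N : finType) (f : {set N} -> rat) :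
    set (point R N) :=
  [set p : point R N | forall pi : {ffun N -> R}, polyhedron f pi ->
    \sum_i pi i * p.1 i <= p.2 :> R].

(* The sum defining the extension when the elements of N are listed as s;     *)
(* x_(i) is the entry of index i.-1 of [seq x j | j <- s].                    *)
Definition lovasz_along (R : realType) (N : finType) (f : {set N} -> rat)
    (x : {ffun N -> R}) (s : seq N) : R :=
  let v := [seq x j | j <- s] in
  let F i : R := ratr (f [set j in take i s]%SET) in
  \sum_(1 <= i < #|N|) (v`_i.-1 - v`_i) * F i + v`_(#|N|.-1) * F #|N|.

Definition decreasing_order (R : realType) (N : finType) (x : {ffun N -> R}) :
    seq N :=
  sort (fun i j => x j <= x i) (enum N).

Definition lovasz (R : realType) (N : finType) (f : {set N} -> rat)
    (x : {ffun N -> R}) : R :=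
  lovasz_along f x (decreasing_order x).

Lemma lovasz_alongE (R : realType) (N : finType) (f : {set N} -> rat)
    (x : {ffun N -> R}) (s : seq N) :
  perm_eq s (enum N) -> sorted (fun i j => x j <= x i) s ->
  lovasz_along f x s = lovasz f x.
Proof.
set r := (fun i j : N => x j <= x i).
have rtr : transitive r by move=> a b c ba cb; apply: le_trans cb ba.
have rtot : total r by move=> a b; apply: le_total.
rewrite /lovasz; set t := decreasing_order x.
move=> ps ss.
have pt : perm_eq t (enum N) by rewrite perm_sort.
have st : sorted r t by exact: sort_sorted.
have pst : perm_eq s t by rewrite (perm_trans ps)// perm_sym.
have vE : [seq x j | j <- s] = [seq x j | j <- t].
  apply: (@sorted_eq _ (fun a b : R => b <= a)).
  - by move=> a b c ba cb; apply: le_trans cb ba.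
  - by move=> a b /andP[ba ab]; apply: le_anti; rewrite ab ba.
  - by rewrite sorted_map.
  - by rewrite sorted_map.
  - exact: perm_map.
have szE (u : seq N) : perm_eq u (enum N) -> size u = #|N|.
  by move=> /perm_size ->; rewrite cardE.
(* a strict drop after position i makes S_(i) an upper level set of x *)
have lvl (u : seq N) i : perm_eq u (enum N) -> sorted r u ->
    (0 < i < #|N|)%N ->
    [seq x j | j <- u]`_i.-1 != [seq x j | j <- u]`_i ->
    [set j in take i u]%SET = [set j | [seq x j | j <- u]`_i < x j]%SET.
  move=> pu su /andP[i0 iN] ne; apply/setP => j; rewrite !inE.
  have szu := szE u pu.
  have ju : j \in u by rewrite (perm_mem pu) mem_enum.
  have := su; rewrite sorted_pairwise // => /pairwiseP-/(_ j) pw.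
  have mono a b : (a <= b < #|N|)%N -> x (nth j u b) <= x (nth j u a).
    case/andP; rewrite leq_eqVlt => /orP[/eqP -> //|ab] bN.
    by apply: pw; rewrite ?inE ?szu // (ltn_trans ab).
  have i1N : (i.-1 < #|N|)%N by rewrite (leq_ltn_trans (leq_pred _)).
  rewrite !(nth_map j) ?szu // in ne *.
  have lt : x (nth j u i) < x (nth j u i.-1).
    by rewrite lt_neqAle eq_sym ne mono // leq_pred.
  rewrite in_take //; set k := index j u.
  have kN : (k < #|N|)%N by rewrite -szu index_mem.
  have xj : x j = x (nth j u k) by rewrite nth_index.
  rewrite [in RHS]xj.
  case: (ltnP k i) => ki.
    by rewrite (lt_le_trans lt) // mono // i1N andbT -ltnS prednK.
  by apply/esym/negbTE; rewrite -leNgt mono // ki.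
rewrite /lovasz_along vE; congr (_ + _).
  rewrite !big_nat; apply: eq_bigr => i iN.
  have [e|ne] := eqVneq ([seq x j | j <- t]`_i.-1) ([seq x j | j <- t]`_i).
    by rewrite e subrr !mul0r.
  by rewrite (lvl t) // (lvl s) // vE.
congr (_ * ratr (f _)).
by apply/setP => j; rewrite !inE !take_oversize ?szE // (perm_mem pst).
Qed.

Definition lovasz_epi (R : realType) (N : finType) (f : {set N} -> rat) :
    set (point R N) :=
  [set p : point R N | @unit_cube R N p.1 /\ lovasz f p.1 <= p.2].

Arguments unit_cube R N : clear implicits.
Arguments epi_hull R {N} f.
Arguments polar R {N} f.
Arguments lovasz_epi R {N} f.

(* Main.v *)
Require Import Defs.
From mathcomp Require Import all_boot all_order all_algebra.
From mathcomp Require Import classical_sets reals convex.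
From mathcomp Require Import unstable interval_inference.
Import Order.TTheory GRing.Theory Num.Theory.
Local Open Scope ring_scope.
Local Open Scope classical_set_scope.

(* List N in decreasing order of the entries of x, let S_i be the set of the  *)
(* first i elements and lambda_i the weights 1 - x_(1), x_(1) - x_(2), ...,   *)
(* x_(n). Then x is the convex combination of the indicators of the S_i with  *)
(* weights lambda_i, and the Lovasz extension of f at x is                    *)
(* sum_i lambda_i f(S_i). Hence the epigraph is inside the hull of the        *)
(* vertices. The hull is inside the polar, because the latter is convex and   *)
(* contains the generators. Finally the greedy vector                         *)
(* pi_(i) = f(S_i) - f(S_(i-1)) belongs to the polyhedron by submodularity    *)
(* and is tight on every S_i, so pi x equals the Lovasz extension at x: this  *)
(* puts the polar (over the cube) inside the epigraph.                        *)

(** The three sets are equal by a cycle of inclusions: [lovasz_epi_sub], [epi_hull_sub],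
    [polar_sub]. [layer_decomposition] writes x as a convex combination of prefix indicators;
    [lovasz_along_layers] and [linear_form_layers] then expand the extension and any linear form
    with the same weights, so they can be compared prefix by prefix. Submodularity enters through
    [greedy_polyhedron]. *)

Lemma convex_set_sum (R : numFieldType) (M : lmodType R) (C : set M)
    (I : finType) (w : I -> R) (p : I -> M) :
  @convex_set R M C -> (forall i, 0 <= w i) -> \sum_i w i = 1 ->
  (forall i, C (p i)) -> C (\sum_i w i *: p i).
Proof.
move=> cC w0 w1 Cp.
have [i0 _|I0] := pickP [pred i : I | true]; last first.
  by move: w1; rewrite big_pred0 // => /esym/eqP; rewrite oner_eq0.
(* Partial sums of weights need not reach 1, so the invariant is that a partial sum is its total
   weight times a point of [C]. *)
pose K (a : R) (v : M) := 0 <= a /\ exists2 c, C c & v = a *: c.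
suff [_ [c Cc ->]] : K (\sum_i w i) (\sum_i w i *: p i).
  by rewrite w1 scale1r.
apply: (big_ind2 K) => [|a u b v [a0 [c Cc ->]] [b0 [d Cd ->]]|i _].
- by split=> //; exists (p i0); rewrite ?scale0r.
- split; first exact: addr_ge0.
  have [ab0|ab0] := eqVneq (a + b) 0.
    exists c => //; move/eqP: ab0; rewrite paddr_eq0 // => /andP[/eqP-> /eqP->].
    by rewrite addr0 !scale0r addr0.
  have ab_gt0 : 0 < a + b by rewrite lt_def ab0 addr_ge0.
  have t0 : 0 <= a / (a + b) by rewrite divr_ge0 // ltW.
  have t1 : a / (a + b) <= 1 by rewrite ler_pdivrMr // mul1r lerDl.
  have := cC c d (@Itv01 R _ t0 t1) (mem_set Cc) (mem_set Cd).
  move=> /set_mem Ct; eexists; first exact: Ct.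
  rewrite /conv /= scalerDr !scalerA mulrCA divff // mulr1.
  by rewrite /onem mulrBr mulr1 mulrCA divff // mulr1 addrAC subrr add0r.
- by split=> //; exists (p i).
Qed.

Section Layers.
Context {R : realType} {N : finType}.
Implicit Types (x : {ffun N -> R}) (s : seq N).

Definition prefix_set s k : {set N} := [set j in take k s]%SET.

Lemma prefix_set0 s : prefix_set s 0 = finset.set0.
Proof. by apply/setP => j; rewrite !inE take0. Qed.

Lemma prefix_set_size s : (forall j, j \in s) ->
  prefix_set s (size s) = [set: N]%SET.
Proof. by move=> sT; apply/setP => j; rewrite !inE take_size sT. Qed.

Lemma prefix_setS s k (j0 : N) : (k < size s)%N ->
  prefix_set s k.+1 = (nth j0 s k |: prefix_set s k)%SET.
Proof.
by move=> ks; apply/setP => j; rewrite !inE (take_nth j0) // mem_rcons inE.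
Qed.

Lemma nth_notin_prefix_set s k (j0 : N) : uniq s -> (k < size s)%N ->
  nth j0 s k \notin prefix_set s k.
Proof. by move=> us ks; rewrite inE in_take ?mem_nth // index_uniq // ltnn. Qed.

(* The leading 1 plays the role of x_(0), and the default value 0 of nth that *)
(* of x_(n+1).                                                                *)
Definition layer_weight x s (i : nat) : R :=
  (1 :: [seq x j | j <- s])`_i - (1 :: [seq x j | j <- s])`_i.+1.

Lemma layer_weight_ge0 x s i : unit_cube R N x ->
  sorted (fun i j => x j <= x i) s -> 0 <= layer_weight x s i.
Proof.
move=> x01 ss; rewrite /layer_weight /= subr_ge0.
have v01 k : 0 <= [seq x j | j <- s]`_k <= 1.
  have [ks|ks] := ltnP k (size s); last first.
    by rewrite nth_default ?size_map ?lexx ?ler01.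
  have : N by case: s {ss} ks => [|a l _].
  by move=> j0; rewrite (nth_map j0).
case: i => [|i] /=; first by case/andP: (v01 0).
have [ks|ks] := ltnP i.+1 (size s); last first.
  by rewrite [leLHS]nth_default ?size_map //; case/andP: (v01 i).
have : sorted (fun a b : R => b <= a) [seq x j | j <- s] by rewrite sorted_map.
by move/(sortedP 0); apply; rewrite size_map.
Qed.

Lemma sum_layer_weight x s m : (m <= (size s).+1)%N ->
  \sum_(m <= i < (size s).+1) layer_weight x s i =
  (1 :: [seq x j | j <- s])`_m.
Proof.
move=> ms; rewrite (telescope_sumr_eq (fun i => - (1 :: [seq x j | j <- s])`_i)) //.
  by rewrite nth_default /= ?size_map // oppr0 add0r opprK.
by move=> k _; rewrite /layer_weight opprK addrC.
Qed.

(** [j] lies in the prefix of length [i] exactly when [index j s < i], so the sum is a tail of the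
    telescoping one. *)
Lemma layer_decomposition x s j : j \in s ->
  \sum_(i < (size s).+1) layer_weight x s i * (j \in prefix_set s i)%:R = x j.
Proof.
move=> js.
have jn : (index j s < size s)%N by rewrite index_mem.
have <- : (1 :: [seq x j | j <- s])`_(index j s).+1 = x j.
  by rewrite /= (nth_map j) // nth_index.
rewrite -sum_layer_weight ?ltnS ?(ltnW jn) // big_geq_mkord [RHS]big_mkcond /=.
apply: eq_bigr => i _; rewrite inE in_take //.
by case: ifP; rewrite (mulr1, mulr0).
Qed.

(** The extra term for the empty prefix vanishes with [f finset.set0], and the separate last term of
    the definition is the weight x_(n) - 0. *)
Lemma lovasz_along_layers (f : {set N} -> rat) x s : f finset.set0 = 0 ->
  size s = #|N| -> (0 < #|N|)%N ->
  lovasz_along f x s =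
  \sum_(i < (size s).+1) layer_weight x s i * ratr (f (prefix_set s i)).
Proof.
move=> f0 sN N0.
rewrite -(big_mkord xpredT
  (fun i => layer_weight x s i * ratr (f (prefix_set s i)))).
rewrite big_nat_recl // prefix_set0 f0 rmorph0 mulr0 add0r.
rewrite -(big_add1 _ _ 0 (size s).+1 xpredT
  (fun i => layer_weight x s i * ratr (f (prefix_set s i)))).
rewrite sN big_nat_recr //=; congr (_ + _).
  rewrite !big_nat; apply: eq_bigr => -[//|i] _.
  by rewrite /layer_weight.
rewrite /layer_weight -[in RHS](prednK N0) /= (prednK N0).
by rewrite [X in _ - X]nth_default ?size_map ?sN // subr0.
Qed.

Lemma linear_form_layers (a : {ffun N -> R}) x s : (forall j, j \in s) ->
  \sum_j a j * x j =
  \sum_(i < (size s).+1) layer_weight x s i * \sum_(j in prefix_set s i) a j.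
Proof.
move=> sT; under [RHS]eq_bigr do rewrite mulr_sumr big_mkcond /=.
rewrite exchange_big /=; apply: eq_bigr => j _.
rewrite -{1}(layer_decomposition x s j (sT j)) mulr_sumr.
by apply: eq_bigr => i _; case: ifP; rewrite ?mulr1 ?mulr0 // mulrC.
Qed.

Definition greedy (f : {set N} -> rat) s : {ffun N -> R} :=
  [ffun j => ratr (f (prefix_set s (index j s).+1)) -
             ratr (f (prefix_set s (index j s)))].

Lemma greedy_tight (f : {set N} -> rat) s k : f finset.set0 = 0 -> uniq s ->
  (k <= size s)%N ->
  \sum_(j in prefix_set s k) greedy f s j = ratr (f (prefix_set s k)).
Proof.
move=> f0 us; elim: k => [_|k IH ks].
  by rewrite prefix_set0 big_set0 f0 rmorph0.
have j0 : N by case: s {us IH} ks => [|a l _].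
rewrite (prefix_setS s k j0) // big_setU1 ?nth_notin_prefix_set //=.
rewrite IH ?(ltnW ks) // ffunE index_uniq // (prefix_setS s k j0) //.
by rewrite subrK.
Qed.

(** Diminishing returns: an element of [T] gains no more when added to a whole prefix than when
    added to the part of it inside [T]. Summing along the order gives the bound. *)
Lemma greedy_polyhedron (f : {set N} -> rat) s : submodular f ->
  f finset.set0 = 0 -> uniq s -> (forall j, j \in s) ->
  polyhedron f (greedy f s).
Proof.
move=> fsub f0 us sT T.
suff H k : (k <= size s)%N ->
    \sum_(j in T :&: prefix_set s k) greedy f s j <=
    ratr (f (T :&: prefix_set s k)%SET).
  by have := H _ (leqnn _); rewrite prefix_set_size // finset.setIT.
elim: k => [_|k IH ks].
  by rewrite prefix_set0 finset.setI0 big_set0 f0 rmorph0.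
have j0 : N by case: s {us sT IH} ks => [|a l _].
have {IH} := IH (ltnW ks); set S := prefix_set s k; set e := nth j0 s k.
have SE : prefix_set s k.+1 = (e |: S)%SET by exact: prefix_setS.
have eS : e \notin S by exact: nth_notin_prefix_set.
rewrite SE finset.setIUr => IH.
have [eT|eT] := boolP (e \in T); last first.
  suff -> : (T :&: [set e])%SET = finset.set0 by rewrite finset.set0U.
  by apply/eqP; rewrite setI_eq0 disjoint_sym disjoints1.
have -> : (T :&: [set e])%SET = [set e]%SET by apply/finset.setIidPr; rewrite finset.sub1set.
rewrite big_setU1 /=; last by rewrite finset.in_setI (negbTE eS) andbF.
apply: (le_trans (lerD (lexx _) IH)).
rewrite ffunE index_uniq // SE addrAC lerBlDr -!rmorphD ler_rat.
(* These two sets have union [e |: S] and intersection [T :&: S]. *)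
have := fsub (e |: T :&: S)%SET S.
rewrite -finset.setUA (finset.setUidPr (finset.subsetIr T S)).
suff -> : ((e |: T :&: S) :&: S = T :&: S)%SET by [].
apply/setP => j; rewrite !(finset.in_setI, finset.in_setU, finset.in_set1).
case: (eqVneq j e) => [->|_] /=.
  by rewrite (negbTE eS) !andbF.
by rewrite -andbA andbb.
Qed.

End Layers.

Lemma epi_hull_sub (R : realType) (N : finType) (f : {set N} -> rat) :
  epi_hull R f `<=` polar R f `&` (unit_cube R N `*` [set: R]).
Proof.
apply: smallest_sub.
  move=> p q t /set_mem[pf [/= p01 _]] /set_mem[qf [/= q01 _]]; apply/mem_set.
  have t0 : 0 <= t%:inum by [].
  have t1 : 0 <= 1 - t%:inum by rewrite subr_ge0.
  split=> [a af|]; last split=> // i /=; rewrite /conv /=.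
    have -> : \sum_i a i * (t%:inum *: p.1 + (1 - t%:inum) *: q.1) i =
        t%:inum * (\sum_i a i * p.1 i) + (1 - t%:inum) * \sum_i a i * q.1 i :> R.
      rewrite !mulr_sumr -big_split; apply: eq_bigr => i _.
      by rewrite !ffunE [LHS]mulrDr; congr (_ + _); exact: mulrCA.
    by apply: lerD; apply: ler_wpM2l => //; [apply: pf | apply: qf].
  rewrite !ffunE; have /andP[p0 p1] := p01 i; have /andP[q0 q1] := q01 i.
  rewrite addr_ge0 ?mulr_ge0 //=.
  rewrite -[leRHS](subrKC t%:inum 1).
  by rewrite lerD // -[leRHS]mulr1 ler_wpM2l.
move=> p [p01 fp]; split=> [a af|]; last first.
  by split=> // i /=; case: (p01 i) => ->; rewrite ?ler01 !lexx ?ler01.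
(* At a 0/1 vector the linear form is the sum of [a] over the support, which membership in the
   polyhedron bounds. *)
apply: le_trans fp; apply: le_trans (af _).
rewrite [leRHS]big_mkcond /=; apply: ler_sum => i _; rewrite inE.
by case: (p01 i) => ->; rewrite ?eqxx ?mulr1 // eq_sym oner_eq0 mulr0.
Qed.

Lemma decreasing_order_mem (R : realType) (N : finType) (x : {ffun N -> R}) j :
  j \in decreasing_order x.
Proof. by rewrite mem_sort mem_enum. Qed.

Lemma size_decreasing_order (R : realType) (N : finType) (x : {ffun N -> R}) :
  size (decreasing_order x) = #|N|.
Proof. by rewrite size_sort -cardE. Qed.

Lemma lovasz_epi_sub (R : realType) (N : finType) (f : {set N} -> rat) :
  (0 < #|N|)%N -> f finset.set0 = 0 -> lovasz_epi R f `<=` epi_hull R f.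
Proof.
move=> N0 f0 [x z] [/= x01 fxz] C [cC genC].
set s := decreasing_order x; set L := lovasz f x in fxz.
have ss : sorted (fun i j => x j <= x i) s.
  by apply: sort_sorted => a b; exact: le_total.
(* The slack [z - L] is added to every vertex; since the weights sum to 1, the combination has
   height exactly [z]. *)
pose p (i : 'I_(size s).+1) : Defs.point R N :=
  ([ffun j => (j \in prefix_set s i)%:R],
   ratr (f (prefix_set s i)) + (z - L)).
have w1 : \sum_(i < (size s).+1) layer_weight x s i = 1.
  by rewrite -(big_mkord xpredT (layer_weight x s)) sum_layer_weight.
suff -> : (x, z) = \sum_(i < (size s).+1) layer_weight x s i *: p i :> Defs.point R N.
  apply: convex_set_sum => // i; first exact: layer_weight_ge0.
  apply: genC; split=> [j|] /=.
    by rewrite ffunE; case: (_ \in _); [right | left].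
  have -> : [set j | (p i).1 j == 1]%SET = prefix_set s i.
    apply/setP => j; rewrite !inE ffunE inE.
    by case: (_ \in _); rewrite ?eqxx // eq_sym oner_eq0.
  by rewrite lerDl subr_ge0.
rewrite [RHS]surjective_pairing !raddf_sum /=; congr (_, _).
  apply/ffunP => j; rewrite sum_ffunE -[LHS](layer_decomposition x s j).
    by apply: eq_bigr => i _; rewrite !ffunE.
  exact: decreasing_order_mem.
under eq_bigr do rewrite [_ *: _]mulrDr.
rewrite big_split /= -mulr_suml w1 mul1r.
rewrite -lovasz_along_layers ?size_decreasing_order //.
by rewrite addrC subrK.
Qed.

Lemma polar_sub (R : realType) (N : finType) (f : {set N} -> rat) :
  (0 < #|N|)%N -> submodular f -> f finset.set0 = 0 ->
  polar R f `&` (unit_cube R N `*` [set: R]) `<=` lovasz_epi R f.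
Proof.
move=> N0 fsub f0 [x z] [/= fxz [/= x01 _]]; split=> //=.
set s := decreasing_order x.
have us : uniq s by rewrite sort_uniq enum_uniq.
have sT j : j \in s by exact: decreasing_order_mem.
apply: le_trans (fxz _ (greedy_polyhedron f s fsub f0 us sT)).
rewrite (linear_form_layers _ _ s) //= /lovasz.
rewrite lovasz_along_layers ?size_decreasing_order //.
(* Equality holds term by term, the greedy vector being tight on every prefix. *)
rewrite le_eqVlt; apply/orP; left; apply/eqP; apply: eq_bigr => i _.
by rewrite greedy_tight // size_decreasing_order -ltnS.
Qed.

Theorem mainTheorem4 (R : realType) (N : finType) (hN : (1 <= #|N|)%N)
    (f : {set N} -> rat) (f_sub : submodular f) (f0 : f finset.set0 = 0) :
  lovasz_epi R f = epi_hull R f /\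
  epi_hull R f = polar R f `&` (unit_cube R N `*` [set: R]).
Proof.
have hull_polar := @epi_hull_sub R N f.
have polar_epi := polar_sub R N f hN f_sub f0.
have epi_hull := lovasz_epi_sub R N f hN f0.
split; apply/seteqP; split=> // p; first by move/hull_polar/polar_epi.
by move/polar_epi/epi_hull.
Qed.
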